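(* Let $G$ be a tree on the vertex set $\{1,\ldots,n\}$, and let $G^{\star}$ be the prism of $G$. Then the universal Gröbner basis of $P_{G}$ is given by the set $$U(P_{G})=\{B_{\Gamma}\mid \Gamma \text{ is an even cycle of } G^{\star}\}.$$
   Context: $K$ is a field. For a simple graph $G$ (finite, undirected, no loops or multiple edges) on $\{1,\ldots,n\}$, let $S=K[\{x_{ij},x_{ji} : \{i,j\}\in E(G)\}\cup\{x_{ii}\}_{1\le i\le n}]$. For $i<j$ put $f_{ij}=x_{ii}x_{jj}-x_{ij}x_{ji}$; $P_G\subset S$ is the ideal generated by all $f_{ij}$ with $\{i,j\}\in E(G)$. The universal Gröbner basis $U(I)$ of an ideal generated by binomials is the union of all its reduced Gröbner bases (over all term orders); binomials are identified up to sign. The prism $G^\star$ is the graph with $2n$ distinct vertices $p_1,\ldots,p_n,q_1,\ldots,q_n$ and the following edges, each identified with a variable of $S$: $\{p_i,q_i\}\leftrightarrow x_{ii}$ for $1\le i\le n$; and for every edge $\{i,j\}$ of $G$ with $i<j$, $\{p_i,p_j\}\leftrightarrow x_{ij}$ and $\{q_i,q_j\}\leftrightarrow x_{ji}$. A cycle of length $l\ge3$ is a closed walk $(\{u_1,u_2\},\ldots,\{u_l,u_1\})$ with $u_1,\ldots,u_l$ distinct; it is even if $l$ is even. For an even cycle $\Gamma=(g_1,\ldots,g_{2l})$ of $G^\star$, with $x(g)$ the variable corresponding to the edge $g$, $B_\Gamma=\prod_{j=1}^{l}x(g_{2j-1})-\prod_{j=1}^{l}x(g_{2j})$ (well defined up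 to sign). *)

(* Defs.v *)
From HB Require Import structures.
From mathcomp Require Import all_boot all_order all_algebra.
From mathcomp Require Import mpoly.

Set Implicit Arguments.
Unset Strict Implicit.
Unset Printing Implicit Defensive.

Import GRing.Theory.
Local Open Scope ring_scope.

Record simple_graph (T : finType) := SimpleGraph {
  adj :> rel T;
  adj_sym : ssrbool.symmetric adj;
  adj_irr : irreflexive adj
}.

(* [:: u_1; ...; u_l] stands for the closed walk {u_1,u_2}, ..., {u_l,u_1}. *)
Definition is_cycle (T : finType) (G : simple_graph T) (c : seq T) : Prop :=
  (2 < size c)%N /\ ucycle (adj G) c.

Definition is_even_cycle (T : finType) (G : simple_graph T) (c : seq T) : Prop :=
  is_cycle G c /\ ~~ odd (size c).

Definition is_tree (T : finType) (G : simple_graph T) : Prop :=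
  [/\ (0 < #|T|)%N, forall u v : T, connect (adj G) u v
    & forall c : seq T, ~ is_cycle G c].

Section Groebner.
Variables (K : fieldType) (N : nat).
Local Notation S := {mpoly K[N]}.

Definition ideal_gen (F : S -> Prop) (p : S) : Prop :=
  exists s : seq (S * S),
    (forall q, q \in s -> F q.2) /\ p = \sum_(q <- s) q.1 * q.2.

Definition term_order (le : rel 'X_{1..N}) : Prop :=
  [/\ [/\ reflexive le, antisymmetric le, transitive le & total le],
      forall m : 'X_{1..N}, le 0%MM m
    & forall m1 m2 m : 'X_{1..N}, le m1 m2 -> le (m1 + m)%MM (m2 + m)%MM].

(* The [le]-greatest monomial in the support of [p]; it is 0%MM if p = 0. *)
Definition lead_mon (le : rel 'X_{1..N}) (p : S) : 'X_{1..N} :=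
  \big[(fun m1 m2 => if le m1 m2 then m2 else m1)/0%MM]_(m <- msupp p) m.

Definition initial_ideal (le : rel 'X_{1..N}) (F : S -> Prop) : S -> Prop :=
  ideal_gen (fun t => exists p : S,
    [/\ F p, p != 0 & t = 'X_[lead_mon le p]]).

Definition is_groebner (le : rel 'X_{1..N}) (I : S -> Prop) (B : seq S) : Prop :=
  (forall g, g \in B -> I g) /\
  (forall t, initial_ideal le I t <-> initial_ideal le (fun g => g \in B) t).

Definition is_reduced_groebner
    (le : rel 'X_{1..N}) (I : S -> Prop) (B : seq S) : Prop :=
  [/\ is_groebner le I B,
      forall g, g \in B -> g@_(lead_mon le g) = 1
    & forall g h m, g \in B -> h \in B -> g != h ->
        m \in msupp g -> ~~ (lead_mon le h <= m)%MM].

Definition universal_groebner (I : S -> Prop) (f : S) : Prop :=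
  exists (le : rel 'X_{1..N}) (B : seq S),
    [/\ term_order le, is_reduced_groebner le I B & f \in B].

Definition up_to_sign (A : S -> Prop) (f : S) : Prop := A f \/ A (- f).

End Groebner.

Section Prism.
Variables (K : fieldType) (n : nat) (G : simple_graph 'I_n).

(* The index pairs (i, j) of the variables x_ij. *)
Definition var : finType :=
  {e : 'I_n * 'I_n | (e.1 == e.2) || adj G e.1 e.2}.

(* x i j is only meaningful if i = j or {i, j} is an edge of G; the value is
   0 otherwise. *)
Definition x (i j : 'I_n) : {mpoly K[#|var|]} :=
  oapp (fun v : var => 'X_(enum_rank v)) 0 (insub (i, j)).

Definition P_gen (f : {mpoly K[#|var|]}) : Prop :=
  exists i j : 'I_n,
    [/\ (i < j)%N, adj G i j & f = x i i * x j j - x i j * x j i].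

Definition P_ideal (f : {mpoly K[#|var|]}) : Prop := ideal_gen P_gen f.

(* inl i is the vertex p_i and inr i is the vertex q_i. *)
Definition prism_adj : rel ('I_n + 'I_n) := fun u v =>
  match u, v with
  | inl i, inl j | inr i, inr j => adj G i j
  | inl i, inr j | inr i, inl j => i == j
  end.

Lemma prism_adj_sym : ssrbool.symmetric prism_adj.
Proof. by case=> i [] j /=; rewrite ?(adj_sym G i j) ?(eq_sym i j). Qed.

Lemma prism_adj_irr : irreflexive prism_adj.
Proof. by case=> i /=; rewrite adj_irr. Qed.

Definition prism : simple_graph ('I_n + 'I_n)%type :=
  SimpleGraph prism_adj_sym prism_adj_irr.

(* The variable identified with the edge {u, v} of the prism. *)
Definition edge_var (u v : 'I_n + 'I_n) : {mpoly K[#|var|]} :=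
  match u, v with
  | inl i, inl j => if (i < j)%N then x i j else x j i
  | inr i, inr j => if (i < j)%N then x j i else x i j
  | inl i, inr _ | inr i, inl _ => x i i
  end.

(* es lists x(g_1), ..., x(g_l), numbered from 0: the factors x(g_(2j-1)) of
   the first product are the entries of es of even index. *)
Definition cycle_binomial (c : seq ('I_n + 'I_n)) : {mpoly K[#|var|]} :=
  let es := [seq edge_var e.1 e.2 | e <- zip c (rot 1 c)] in
  \prod_(j < (size c)./2) es`_(j.*2) - \prod_(j < (size c)./2) es`_(j.*2.+1).

Definition even_cycle_binomial (f : {mpoly K[#|var|]}) : Prop :=
  exists c : seq ('I_n + 'I_n), is_even_cycle prism c /\ f = cycle_binomial c.

End Prism.

Arguments P_ideal K {n} G f.
Arguments even_cycle_binomial K {n} G f.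

(* Main.v *)
Require Import Defs.
From HB Require Import structures.
From mathcomp Require Import all_boot all_order all_algebra.
From mathcomp Require Import mpoly zify.

Set Implicit Arguments.
Unset Strict Implicit.
Unset Printing Implicit Defensive.

Import Order.TTheory GRing.Theory Num.Theory.
Local Open Scope ring_scope.

(** For a tree G, the ideal P_G is the toric ideal of the prism: the kernel of the
    map sending the variable of an edge {u, v} to the product y_u y_v. Indeed
    the generator f_ij is the binomial of the square p_i p_j q_j q_i
    ([square_deg]). Conversely, if two monomials have the same image, the
    differences of their exponents at x_ij and at x_ji are equal, because the
    defect is a system of weights on the edges of G with sum 0 at every vertex,
    and a forest carries none but 0 ([forest_no_flow]). Hence one monomial can be
    moved towards the other by replacing some x_ij x_ji with x_ii x_jj
    ([P_step]), and the binomials thus obtained span the kernel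
    ([toric_binomials_span]).

    As G is bipartite, so is the prism, and for any bipartite graph the universal
    Groebner basis of the toric ideal consists of the binomials of the cycles
    ([bipartite_universal_groebner]). Let m and m' be distinct monomials with the same
    image. Orient the edges where m exceeds m' from the first colour to the
    second, and those where m' exceeds m the other way: this gives a flow
    conserved at every vertex, hence a directed cycle ([circulation_cycle]), whose two
    monomials divide m and m' respectively ([flow_conformal]). If moreover
    m and m' only involve the edges of one cycle, the flow is constant along it, so
    the two monomials of that very cycle divide them ([flow_circuit]).

    These two properties determine the universal Groebner basis
    ([universal_groebner_circuits]). An element of a reduced basis is the
    difference of a minimal non-standard monomial m and a standard one m' of the
    same multidegree ([reduced_groebner_elt]); by the first property it is divided
    termwise by a cycle binomial, and minimality leaves only equality. Conversely,
    given a cycle, take a term order in which every variable outside of the cycle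
    exceeds all the monomials in the variables of the cycle. The comparisons
    deciding that the binomial belongs to the reduced basis take place between
    monomials in the variables of the cycle, where the second property
    governs them ([circuit_universal]). *)
(** * Ideals generated by a set, and leading monomials *)

Section IdealGen.
Variables (K : fieldType) (N : nat).
Local Notation S := {mpoly K[N]}.
Implicit Types (F J : S -> Prop) (p q : S) (m : 'X_{1..N}).

(** The ideal generated by F is contained in every ideal J containing F; this
    serves as an induction principle. *)
Lemma ideal_gen_min F J :
    J 0 -> (forall p q, J p -> J q -> J (p + q)) ->
    (forall a p, J p -> J (a * p)) -> (forall g, F g -> J g) ->
  forall p, ideal_gen F p -> J p.
Proof.
move=> J0 JD JM FJ p [s [sF ->]].
elim: s sF => [|q s IHs] sF; first by rewrite big_nil.
rewrite big_cons; apply: JD; first by apply/JM/FJ/sF; rewrite mem_head.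
by apply: IHs => r rs; apply: sF; rewrite inE rs orbT.
Qed.

Lemma ideal_gen_in F g : F g -> ideal_gen F g.
Proof.
move=> Fg; exists [:: (1, g)]; rewrite big_seq1 mul1r; split=> // q.
by rewrite inE => /eqP ->.
Qed.

Lemma ideal_gen0 F : ideal_gen F 0.
Proof. by exists [::]; rewrite big_nil. Qed.

Lemma ideal_genD F p q : ideal_gen F p -> ideal_gen F q -> ideal_gen F (p + q).
Proof.
move=> [s [sF ->]] [s' [sF' ->]]; exists (s ++ s'); rewrite big_cat.
by split=> // r; rewrite mem_cat => /orP[/sF|/sF'].
Qed.

Lemma ideal_genM F a p : ideal_gen F p -> ideal_gen F (a * p).
Proof.
move=> [s [sF ->]]; exists [seq (a * q.1, q.2) | q : S * S <- s]; split.
  by move=> r /mapP[q qs ->] /=; apply: sF.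
by rewrite big_map mulr_sumr; apply: eq_bigr => q _; rewrite mulrA.
Qed.

Lemma ideal_gen_sub F F' :
  (forall g, F g -> ideal_gen F' g) -> forall p, ideal_gen F p -> ideal_gen F' p.
Proof.
move=> FF'; apply: ideal_gen_min => //; first exact: ideal_gen0.
- exact: ideal_genD.
- exact: ideal_genM.
Qed.

(** When F consists of monomials, the polynomials all of whose monomials are
    multiples of elements of F already form an ideal. *)
Lemma mon_ideal_dvd F m :
    (forall g, F g -> exists t, g = 'X_[t]) -> ideal_gen F 'X_[m] ->
  exists2 t, F 'X_[t] & (t <= m)%MM.
Proof.
move=> monF /(@ideal_gen_min F
  (fun p => forall m, m \in msupp p -> exists2 t, F 'X_[t] & (t <= m)%MM)).
apply; last by rewrite msuppX mem_head.
- by move=> m'; rewrite msupp0.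
- by move=> p q Jp Jq m' /msuppD_le; rewrite mem_cat => /orP[/Jp|/Jq].
- move=> a p Jp m' /msuppM_le /allpairsP[[m1 m2] /= [_ /Jp[t Ft le_t] ->]].
  by exists t => //; apply: lepm_trans le_t (lem_addl _ _).
- move=> g Fg m'; have [t def_g] := monF g Fg.
  rewrite def_g msuppX inE => /eqP ->; exists t; last exact: lepm_refl.
  by rewrite -def_g.
Qed.

End IdealGen.

Section LeadMon.
Variables (K : fieldType) (N : nat) (le : rel 'X_{1..N}).
Hypothesis ord : term_order le.
Local Notation S := {mpoly K[N]}.
Implicit Types (p : S) (m : 'X_{1..N}).

Lemma tle_refl m : le m m. Proof. by case: ord => [[]]. Qed.
Lemma tle_anti m m' : le m m' -> le m' m -> m = m'.
Proof. by case: ord => [[_ anti _ _] _ _ h h']; apply: anti; rewrite h. Qed.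
Lemma tle_trans m2 m1 m3 : le m1 m2 -> le m2 m3 -> le m1 m3.
Proof. by case: ord => [[_ _ tr _] _ _]; apply: tr. Qed.
Lemma tle_total m m' : le m m' || le m' m.
Proof. by case: ord => [[_ _ _ tot] _ _]. Qed.
Lemma tle_add m1 m2 m : le m1 m2 -> le (m1 + m)%MM (m2 + m)%MM.
Proof. by case: ord => _ _; apply. Qed.

Lemma tle_dvd m m' : (m <= m')%MM -> le m m'.
Proof.
move=> /submK <-; rewrite -{1}[m]add0m.
by apply: tle_add; case: ord.
Qed.

Lemma lead_monP p : p != 0 ->
  lead_mon le p \in msupp p /\ forall m, m \in msupp p -> le m (lead_mon le p).
Proof.
rewrite -msupp_eq0 /lead_mon; elim: (msupp p) => [//|m s IHs] _.
rewrite big_cons; case: (eqVneq s [::]) => [-> | /IHs [top_s max_s]].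
  rewrite big_nil; case: ifPn => [m0 | _]; last first.
    by split=> [|m']; rewrite !inE ?eqxx // => /eqP ->; apply: tle_refl.
  have -> : m = 0%MM by apply: tle_anti m0 _; case: ord.
  by split=> [|m']; rewrite !inE ?eqxx // => /eqP ->; apply: tle_refl.
set b := \big[_/_]_(_ <- s) _ in top_s max_s *.
case: ifPn => [le_mb | nle_mb].
  split=> [|m']; rewrite inE ?top_s ?orbT // => /predU1P[-> //|].
  exact: max_s.
have le_bm : le b m by have := tle_total m b; rewrite (negPf nle_mb).
split=> [|m']; rewrite inE ?eqxx // => /predU1P[->|/max_s le_m'b].
  exact: tle_refl.
exact: tle_trans le_m'b le_bm.
Qed.

Lemma lead_mon_eq p m :
  m \in msupp p -> (forall m', m' \in msupp p -> le m' m) -> lead_mon le p = m.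
Proof.
move=> mp max_m; have p0 : p != 0.
  by apply: contraTneq mp => ->; rewrite msupp0.
by have [lp max_l] := lead_monP p0; apply: tle_anti; [apply: max_m | apply: max_l].
Qed.

End LeadMon.

(** * Groebner bases of toric ideals *)

Section Toric.
Variables (K : fieldType) (N M : nat) (A : 'I_N -> 'X_{1..M}).
Hypothesis A_neq0 : forall k, A k != 0%MM.
Local Notation S := {mpoly K[N]}.
Implicit Types (p q f g : S) (m u v w : 'X_{1..N}) (le : rel 'X_{1..N}).

(** The grading of the monomials for which the toric ideal is spanned by the
    differences of monomials of the same degree. *)
Definition tdeg m : 'X_{1..M} := (\sum_(k < N) A k *+ m k)%MM.

Definition toric_map (p : S) : {mpoly K[M]} :=
  mmap (@mpolyC M K) (fun k => 'X_[A k]) p.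

Lemma tdegE m j : tdeg m j = (\sum_k A k j * m k)%N.
Proof. by rewrite mnm_sumE; apply: eq_bigr => k _; rewrite mulmnE. Qed.

Lemma tdegD m m' : tdeg (m + m')%MM = (tdeg m + tdeg m')%MM.
Proof.
apply/mnmP => j; rewrite mnmDE !tdegE -big_split.
by apply: eq_bigr => k _; rewrite mnmDE mulnDr.
Qed.

(** As no variable has multidegree 0, fibers of the grading are finite. *)
Lemma mdeg_le_tdeg m : (mdeg m <= mdeg (tdeg m))%N.
Proof.
rewrite mdeg_sum mdegE; apply: leq_sum => k _; rewrite mdegMn.
by rewrite leq_pmull // lt0n mdeg_eq0.
Qed.

(** The quotient has multidegree 0, hence is 1. *)
Lemma tdeg_dvd_eq m m' : (m <= m')%MM -> tdeg m = tdeg m' -> m = m'.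
Proof.
move=> /submK <-; rewrite tdegD -{1}[tdeg m]add0m => /eqP.
rewrite eqm_add2r eq_sym => /eqP d0.
have : (mdeg (m' - m) <= 0)%N by rewrite -(@mdeg0 M) -d0 mdeg_le_tdeg.
by rewrite leqn0 mdeg_eq0 => /eqP ->; rewrite add0m.
Qed.

Lemma toric_mapX m : toric_map 'X_[m] = 'X_[tdeg m].
Proof.
by rewrite /toric_map mmapX /mmap1 mprodXnE.
Qed.

Lemma toric_mapB p q : toric_map (p - q) = toric_map p - toric_map q.
Proof. by rewrite /toric_map mmapB. Qed.

Lemma toric_binomial m m' : tdeg m = tdeg m' -> toric_map ('X_[m] - 'X_[m']) = 0.
Proof. by move=> eqd; rewrite toric_mapB !toric_mapX eqd subrr. Qed.

Lemma toric_map_coef p t :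
  (toric_map p)@_t = \sum_(m <- msupp p | tdeg m == t) p@_m.
Proof.
rewrite /toric_map /mmap raddf_sum [RHS]big_mkcond /=; apply: eq_bigr => m _.
rewrite mcoeffCM /mmap1 mprodXnE mcoeffX -/(tdeg m).
by case: eqP; rewrite ?mulr1 ?mulr0.
Qed.

(** The coefficients of an element of the toric ideal add up to 0 on each
    fiber, so none of its monomials can be alone in its fiber. *)
Lemma toric_mate p m : toric_map p = 0 -> m \in msupp p ->
  exists m', [/\ m' \in msupp p, m' != m & tdeg m' = tdeg m].
Proof.
move=> p0 mp.
case: (boolP (has (fun m' => (m' != m) && (tdeg m' == tdeg m)) (msupp p))).
  by case/hasP => m' m'p /andP[ne /eqP eqd]; exists m'.
move=> /hasPn alone; have := congr1 (mcoeff (tdeg m)) p0.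
rewrite toric_map_coef mcoeff0 big_mkcond (bigD1_seq m) ?msupp_uniq //= eqxx.
rewrite big_seq_cond big1 ?addr0 => [/eqP|]; first by rewrite mcoeff_eq0 mp.
by move=> m' /andP[/alone]; case: eqP => //= _ /negPf ->.
Qed.

(** Any ideal containing all the binomials of the toric ideal contains it: a
    monomial can be cancelled against another one of the same fiber. *)
Lemma toric_binomials_span (J : S -> Prop) :
    J 0 -> (forall p q, J p -> J q -> J (p + q)) ->
    (forall a p, J p -> J (a * p)) ->
    (forall m m', tdeg m = tdeg m' -> J ('X_[m] - 'X_[m'])) ->
  forall p, toric_map p = 0 -> J p.
Proof.
move=> J0 JD JM Jbin p; have [k] := ubnP (size (msupp p)).
elim: k p => // k IHk p; rewrite ltnS => size_p p0.
have [->//|nz_p] := eqVneq p 0.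
have [m mp]: exists m, m \in msupp p.
  move: nz_p; rewrite -msupp_eq0; case: (msupp p) => // m s.
  by exists m; rewrite mem_head.
have [m' [m'p nem eqd]] := toric_mate p0 mp.
pose b : S := 'X_[m] - 'X_[m'].
rewrite -[p](subrK (p@_m *: b)) -mul_mpolyC; apply: JD; last by apply/JM/Jbin.
apply: IHk; last first.
  rewrite toric_mapB p0 mul_mpolyC /toric_map mmapZ -/(toric_map b).
  by rewrite toric_binomial // mulr0 subr0.
(* The cancellation removes m from the support and adds nothing, since m'
   was already there. *)
apply: leq_trans _ size_p; rewrite mul_mpolyC.
have: uniq (m :: msupp (p - p@_m *: b)).
  rewrite /= msupp_uniq andbT -mcoeff_eq0 mcoeffB mcoeffZ mcoeffB !mcoeffX eqxx.
  by rewrite (negPf nem) subr0 mulr1 subrr.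
move/uniq_leq_size=> leq_s; apply: leq_s => w; rewrite inE => /predU1P[-> //|].
move=> /msuppB_le; rewrite mem_cat => /orP[//|/msuppZ_le/msuppB_le].
by rewrite mem_cat !msuppX !inE => /orP[] /eqP ->.
Qed.

End Toric.

Section StandardMonomials.
Variables (N M : nat) (A : 'I_N -> 'X_{1..M}).
Hypothesis A_neq0 : forall k, A k != 0%MM.
Variable le : rel 'X_{1..N}.
Hypothesis ord : term_order le.
Local Notation deg := (tdeg A).
Implicit Types (m u v w : 'X_{1..N}).

(** The monomials outside the initial ideal of the toric ideal are those that are
    least in their fiber. The fiber is finite, and bounding the total degree
    of its elements makes the property decidable. *)
Definition standard m :=
  [forall m' : 'X_{1..N < (mdeg (deg m)).+1}, (deg m' == deg m) ==> le m m'].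

Lemma standardP m :
  reflect (forall m', deg m' = deg m -> le m m') (standard m).
Proof.
apply: (iffP forallP) => [min_m m' eqd | min_m m'].
  have lt_m' : (mdeg m' < (mdeg (deg m)).+1)%N.
    by rewrite ltnS -eqd mdeg_le_tdeg.
  by have := min_m (BMultinom lt_m'); rewrite /= eqd eqxx.
by apply/implyP => /eqP /min_m.
Qed.

(** A fiber, being finite, has a least element. *)
Lemma standard_rep m : exists m', standard m' && (deg m' == deg m).
Proof.
have lt_m : (mdeg m < (mdeg (deg m)).+1)%N by rewrite ltnS mdeg_le_tdeg.
pose P (w : 'X_{1..N < (mdeg (deg m)).+1}) := deg w == deg m.
have Pm : P (BMultinom lt_m) by rewrite /P.
case: (@fintype.extremumP _ _ le (BMultinom lt_m) P (@bmnm N _)) => //.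
- exact: tle_refl.
- exact: tle_trans.
- exact: tle_total.
move=> w /eqP dw min_w; exists (bmnm w); rewrite dw eqxx andbT.
apply/standardP => m'; rewrite dw => dm'.
have lt_m' : (mdeg m' < (mdeg (deg m)).+1)%N by rewrite ltnS -dm' mdeg_le_tdeg.
by apply: (min_w (BMultinom lt_m')); rewrite /P /= dm'.
Qed.

Lemma standard_uniq m m' :
  standard m -> standard m' -> deg m = deg m' -> m = m'.
Proof.
by move=> /standardP min_m /standardP min_m' eqd; apply: (tle_anti ord); auto.
Qed.

Lemma standard_dvd m m' : (m <= m')%MM -> standard m' -> standard m.
Proof.
move=> le_mm' /standardP min_m'; apply/standardP => w eqd.
have /orP[//|le_wm] := tle_total ord m w.
(* If w precedes m, then w + (m' - m) precedes m', hence equals it. *)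
have eqd' : deg (w + (m' - m))%MM = deg m'.
  by rewrite tdegD eqd -tdegD addmC submK.
have := tle_anti ord (min_m' _ eqd') _; rewrite -{2}(submK le_mm') [X in le _ X]addmC.
move/(_ (tle_add ord _ le_wm)) => eq_m'.
move: (submK le_mm'); rewrite {2}eq_m' addmC => /addIm ->.
exact: tle_refl.
Qed.

(** The minimal generators of the initial ideal. *)
Definition corner m :=
  ~~ standard m && [forall k, (m k != 0%N) ==> standard (m - U_(k))%MM].

Lemma corner_dvd m w : corner m -> (w <= m)%MM -> ~~ standard w -> w = m.
Proof.
case/andP => _ /forallP cor_m le_wm; apply: contraNeq => ne_wm.
have [k lt_k] : exists k, (w k < m k)%N.
  apply/existsP; apply: contraNT ne_wm; rewrite negb_exists => /forallP ge_w.
  apply/eqP/mnmP => k; apply/eqP; rewrite eqn_leq (mnm_lepP le_wm k) /=.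
  by rewrite leqNgt.
have mk0 : m k != 0%N by rewrite -lt0n (leq_trans _ lt_k).
apply: standard_dvd (implyP (cor_m k) mk0).
apply/mnm_lepP => j; rewrite mnmBE mnm1E; case: eqP => [<-|_].
  by rewrite subn1 -ltnS prednK // lt0n.
by rewrite subn0 (mnm_lepP le_wm).
Qed.

(** Removing variables one at a time while the monomial stays non-standard
    ends at a corner. *)
Lemma corner_exists m : ~~ standard m -> exists2 w, corner w & (w <= m)%MM.
Proof.
have [d] := ubnP (mdeg m); elim: d m => // d IHd m; rewrite ltnS => le_d nsm.
have [cm|] := boolP (corner m); first by exists m => //; apply: lepm_refl.
rewrite /corner nsm /= => /forallPn[k]; rewrite negb_imply => /andP[mk0 nsk].
have le_k : (U_(k) <= m)%MM by rewrite lep1mP.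
case: (IHd _ _ nsk) => [|w cw le_w].
  by apply: leq_trans le_d; rewrite -{2}(submK le_k) mdegD mdeg1 addn1.
by exists w => //; apply: lepm_trans le_w (lem_subr _ _).
Qed.

Section Groebner.
Variable K : fieldType.
Local Notation S := {mpoly K[N]}.
Implicit Types (f g p : S) (B : seq S).

(** The leading monomial has a companion in its fiber, which precedes it. *)
Lemma lead_nonstandard p :
  toric_map A p = 0 -> p != 0 -> ~~ standard (lead_mon le p).
Proof.
move=> p0 nz_p; have [lp max_l] := lead_monP ord nz_p.
have [m' [m'p ne eqd]] := toric_mate p0 lp.
apply: contra_neqN ne => /standardP /(_ _ eqd) le_lm'.
by apply: (tle_anti ord) (max_l _ m'p) _.
Qed.

Lemma lead_binomial m m' : m != m' -> le m' m ->
  lead_mon le ('X_[m] - 'X_[m'] : S) = m.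
Proof.
move=> ne le_m; apply: (lead_mon_eq ord) => [|w].
  rewrite mcoeff_msupp mcoeffB !mcoeffX eqxx [m' == m]eq_sym (negPf ne) subr0.
  exact: oner_neq0.
move=> /msuppB_le; rewrite mem_cat !msuppX !inE => /orP[] /eqP -> //.
exact: tle_refl.
Qed.

Variable I : S -> Prop.
Hypothesis toricI : forall p, I p <-> toric_map A p = 0.

Lemma nonstandard_initial m : ~~ standard m -> initial_ideal le I 'X_[m].
Proof.
move=> nsm; have [m' /andP[sm' /eqP eqd]] := standard_rep m.
have ne : m != m' by apply: contraNneq nsm => ->.
have le_m : le m' m by apply/(standardP _ sm').
have lb := lead_binomial ne le_m; apply: ideal_gen_in.
exists ('X_[m] - 'X_[m']); rewrite lb; split=> //.
  by apply/toricI/toric_binomial.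
apply/eqP => b0; move: (congr1 (mcoeff m) b0).
rewrite mcoeffB !mcoeffX eqxx [m' == m]eq_sym (negPf ne) subr0 mcoeff0 => /eqP.
by rewrite oner_eq0.
Qed.

(** In a reduced basis the tail of an element is standard, so that every fiber
    but the one of the leading monomial would meet its support in a single
    monomial. *)
Lemma reduced_groebner_elt B f : is_reduced_groebner le I B -> f \in B ->
  exists m m', [/\ corner m, standard m', deg m' = deg m
                 & f = 'X_[m] - 'X_[m']].
Proof.
move=> [[BI inB] monicB redB] fB.
have f0 : toric_map A f = 0 by apply/toricI/BI.
have nz_f : f != 0.
  apply: contra_eq_neq (monicB f fB) => ->; rewrite mcoeff0 eq_sym.
  exact: oner_neq0.
pose m := lead_mon le f; have [mf max_m] := lead_monP ord nz_f.
have nsm : ~~ standard m by apply: lead_nonstandard.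
have leadB w : ~~ standard w -> exists2 h, h \in B & (lead_mon le h <= w)%MM.
  move=> /nonstandard_initial /inB inw.
  case: (mon_ideal_dvd _ inw) => [_ [h [_ _ ->]] | t]; first by exists (lead_mon le h).
  case=> h [hB _ /(congr1 (mcoeff t))]; rewrite !mcoeffX eqxx.
  case: eqP => [<- _ | _ /eqP]; first by exists h.
  by rewrite oner_eq0.
have tail w : w \in msupp f -> w != m -> standard w.
  move=> wf ne; apply: contraTT (wf) => nsw; apply/negP => _.
  have [h hB le_h] := leadB w nsw; have [eq_fh | ne_fh] := eqVneq f h.
    move/negP: ne; apply; apply/eqP/(tle_anti ord); first exact: max_m.
    by apply: (tle_dvd ord); rewrite /m eq_fh.
  by have /negP := redB f h w fB hB ne_fh wf.
have [m' [m'f ne' eqd]] := toric_mate f0 mf.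
have sm' : standard m' := tail m' m'f ne'.
have cm : corner m.
  rewrite /corner nsm; apply/forallP => k; apply/implyP => mk0.
  apply: contraT => nsk; have [h hB le_h] := leadB _ nsk.
  have le_hm := lepm_trans le_h (lem_subr _ _).
  have [eq_fh | ne_fh] := eqVneq f h; last by have /negP := redB f h m fB hB ne_fh mf.
  move/mnm_lepP/(_ k): le_h; rewrite -eq_fh -/m mnmBE mnm1E eqxx subn1.
  by case: (m k) mk0 => // j _; rewrite ltnn.
exists m, m'; split=> //.
have supp_f w : w \in msupp f -> (w == m) || (w == m').
  move=> wf; case: eqVneq => //= ne.
  have [w' [w'f new' eqd']] := toric_mate f0 wf.
  have [eq_w'|ne_w'] := eqVneq w' m.
    apply/eqP/standard_uniq => //; first exact: tail.
    by rewrite -eqd' eq_w' eqd.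
  have := standard_uniq (tail _ w'f ne_w') (tail _ wf ne) eqd'.
  by move/eqP: new'.
have fm : f@_m = 1 by apply: monicB.
(* The difference of f and the binomial is supported on m' alone. *)
apply/eqP; rewrite -subr_eq0; apply: contraT => nz_g.
pose g : S := f - ('X_[m] - 'X_[m']).
have g0 : toric_map A g = 0 by rewrite toric_mapB f0 toric_binomial // subr0.
have supp_g w : w \in msupp g -> w = m'.
  move=> wg; have : (w == m) || (w == m').
    move: wg => /msuppB_le; rewrite mem_cat => /orP[/supp_f //|/msuppB_le].
    by rewrite mem_cat !msuppX !inE.
  case/orP => /eqP // eq_wm; move: wg; rewrite mcoeff_msupp eq_wm !mcoeffB.
  by rewrite !mcoeffX eqxx fm (negPf ne') subr0 subrr eqxx.
have [lg _] := lead_monP ord nz_g.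
by have [w [/supp_g ->]] := toric_mate g0 lg; rewrite (supp_g _ lg) eqxx.
Qed.

(** Each corner, paired with the standard monomial of its fiber, contributes one
    element; bounding the degrees of the corners makes the basis finite. *)
Lemma reduced_groebner_exists D : (forall m, corner m -> (mdeg m <= D)%N) ->
  exists2 B, is_reduced_groebner le I B
    & forall m m', corner m -> standard m' -> deg m' = deg m ->
        'X_[m] - 'X_[m'] \in B.
Proof.
move=> bound.
pose rep m := xchoose (standard_rep m).
have repP m : standard (rep m) /\ deg (rep m) = deg m.
  by have /andP[? /eqP] := xchooseP (standard_rep m).
pose L := [seq m <- [seq bmnm b | b <- enum {: 'X_{1..N < D.+1}}] | corner m].
have memL m : (m \in L) = corner m.
  rewrite mem_filter andb_idr // => /bound le_m; apply/mapP.
  by exists (BMultinom (le_m : (mdeg m < D.+1)%N)); rewrite // mem_enum.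
pose B : seq S := [seq 'X_[m] - 'X_[rep m] | m <- L].
have leadB m : corner m ->
    [/\ m != rep m, 'X_[m] - 'X_[rep m] != 0 :> S
      & lead_mon le ('X_[m] - 'X_[rep m] : S) = m].
  move=> /andP[nsm _]; have [sm eqd] := repP m.
  have ne : m != rep m by apply: contraNneq nsm => ->.
  split=> //; last by apply: lead_binomial ne _; apply: (standardP _ sm).
  apply/eqP => /(congr1 (mcoeff m)) /eqP; rewrite mcoeffB !mcoeffX eqxx.
  by rewrite [rep m == m]eq_sym (negPf ne) subr0 mcoeff0 oner_eq0.
have inB m m' : corner m -> standard m' -> deg m' = deg m ->
    'X_[m] - 'X_[m'] \in B.
  move=> cm sm' eqd; apply/mapP; exists m; first by rewrite memL.
  have [srm eqdr] := repP m.
  by rewrite (standard_uniq sm' srm) // eqdr.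
exists B => //; split.
- have BI g : g \in B -> I g.
    move=> /mapP[m _ ->]; apply/toricI/toric_binomial.
    by rewrite (repP m).2.
  split=> // t; split; apply: ideal_gen_sub => _ [p [Ip nz_p ->]].
    have := lead_nonstandard (iffLR (toricI p) Ip) nz_p.
    case/corner_exists => w cw /submK <-; rewrite mpolyXD; apply: ideal_genM.
    have [ne nz lw] := leadB w cw; apply: ideal_gen_in.
    exists ('X_[w] - 'X_[rep w]); rewrite lw; split=> //.
    by apply: map_f; rewrite memL.
  by apply: ideal_gen_in; exists p; split=> //; apply: BI.
- move=> _ /mapP[m Lm ->]; rewrite memL in Lm; have [ne _ ->] := leadB m Lm.
  by rewrite mcoeffB !mcoeffX eqxx [rep m == m]eq_sym (negPf ne) subr0.
- move=> _ _ w /mapP[m Lm ->] /mapP[u Lu ->] ne_mu.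
  rewrite !memL in Lm Lu; have [_ _ ->] := leadB u Lu.
  have nsu : ~~ standard u by case/andP: Lu.
  have [srm _] := repP m.
  move=> /msuppB_le; rewrite mem_cat !msuppX !inE => /orP[] /eqP ->.
    apply: contraNN ne_mu => /(corner_dvd Lm) /(_ nsu) -> //.
  by apply: contraNN nsu => /standard_dvd; apply.
Qed.

End Groebner.
End StandardMonomials.

(** * Toric ideals whose Graver basis consists of circuits *)

Section Elimination.
Variables (N : nat) (P : pred 'I_N).
Implicit Types (m : 'X_{1..N}).

Definition outer_weight m := (\sum_(k | ~~ P k) m k)%N.

(** Any variable outside P is larger than all the monomials in P. *)
Definition elim_le : rel 'X_{1..N} := fun m1 m2 =>
  (outer_weight m1 < outer_weight m2)%N
  || (outer_weight m1 == outer_weight m2) && (m1 <= m2)%O.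

Lemma outer_weightD m m' :
  outer_weight (m + m')%MM = (outer_weight m + outer_weight m')%N.
Proof. by rewrite /outer_weight -big_split; apply: eq_bigr => k _; rewrite mnmDE. Qed.

Lemma outer_weight_eq0 m :
  (outer_weight m == 0%N) = [forall k, (m k != 0%N) ==> P k].
Proof.
rewrite sum_nat_eq0; apply: eq_forallb => k; rewrite /=.
by case: (P k); case: (m k == 0%N).
Qed.

Lemma elim_term_order : term_order elim_le.
Proof.
rewrite /elim_le; split; first split.
- by move=> m; rewrite eqxx Order.POrderTheory.lexx orbT.
- move=> m1 m2; case: ltngtP => //= _; exact: Order.POrderTheory.le_anti.
- move=> m2 m1 m3 /orP[lt12|/andP[/eqP -> le12]] /orP[lt23|/andP[/eqP e23 le23]].
  + by rewrite (ltn_trans lt12 lt23).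
  + by rewrite -e23 lt12.
  + by rewrite lt23.
  + by rewrite e23 eqxx (Order.POrderTheory.le_trans le12 le23) orbT.
- move=> m1 m2; case: ltngtP => //= _; exact: Order.TotalTheory.le_total.
- move=> m; case: (ltngtP (outer_weight 0%MM)) => //=; last by rewrite le0m.
  suff -> : outer_weight 0%MM = 0%N by rewrite ltn0.
  by apply: big1 => k _; rewrite mnm0E.
- by move=> m1 m2 m; rewrite !outer_weightD ltn_add2r eqn_add2r lemc_add2l.
Qed.

End Elimination.

Section CircuitBasis.
Variables (K : fieldType) (N M D : nat) (A : 'I_N -> 'X_{1..M}).
Hypothesis A_neq0 : forall k, A k != 0%MM.
Local Notation S := {mpoly K[N]}.
Local Notation deg := (tdeg A).
Implicit Types (m u v : 'X_{1..N}) (f : S).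

Variables (I : S -> Prop) (C : 'X_{1..N} -> 'X_{1..N} -> Prop).
Hypothesis toricI : forall p, I p <-> toric_map A p = 0.
Hypothesis C_bound : forall u v, C u v -> (mdeg u <= D)%N.
Hypothesis C_deg : forall u v, C u v -> deg u = deg v.
Hypothesis C_neq : forall u v, C u v -> u != v.
(* The pairs in C dominate the Graver basis: they divide, termwise and without
   cancellation, any binomial of the toric ideal. *)
Hypothesis C_conformal : forall m m', deg m = deg m' -> m != m' ->
  exists u v, [/\ C u v, (u <= m)%MM & (v <= m')%MM].
(* In the variables of a pair in C, that pair is the only primitive relation. *)
Hypothesis C_circuit : forall u v m m', C u v -> deg m = deg m' -> m != m' ->
  (forall k, (m k != 0%N) || (m' k != 0%N) -> (u k != 0%N) || (v k != 0%N)) ->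
  (u <= m)%MM /\ (v <= m')%MM \/ (v <= m)%MM /\ (u <= m')%MM.

(** A pair of C dividing the corner m and its standard companion m' termwise is
    all of it, since m is a minimal non-standard monomial. *)
Lemma corner_circuit le m m' : term_order le ->
  corner A le m -> standard A le m' -> deg m' = deg m -> C m m'.
Proof.
move=> ord cm sm' eqd; have /andP[nsm _] := cm.
have ne : m != m' by apply: contraNneq nsm => ->.
have [u [v [Cuv le_u le_v]]] := C_conformal (esym eqd) ne.
have sv : standard A le v := standard_dvd A_neq0 ord le_v sm'.
have nsu : ~~ standard A le u.
  apply: contraNN (C_neq Cuv) => su; apply/eqP.
  exact: (standard_uniq A_neq0 ord su sv (C_deg Cuv)).
have eq_um := corner_dvd A_neq0 ord cm le_u nsu.
have eq_vm' : v = m'.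
  by apply: (tdeg_dvd_eq A_neq0 le_v); rewrite eqd -eq_um (C_deg Cuv).
by rewrite -eq_um -eq_vm'.
Qed.

(** For the order eliminating the variables that do not occur in the circuit,
    everything below u or a divisor of u or v is a monomial in the variables of
    the circuit; and there, the binomial of the circuit divides termwise any other
    binomial of the toric ideal. *)
Lemma circuit_universal u v : deg u = deg v -> u != v ->
    (forall m m', deg m = deg m' -> m != m' ->
      (forall k, (m k != 0%N) || (m' k != 0%N) -> (u k != 0%N) || (v k != 0%N)) ->
      (u <= m)%MM /\ (v <= m')%MM \/ (v <= m)%MM /\ (u <= m')%MM) ->
    elim_le (fun k => (u k != 0%N) || (v k != 0%N)) v u ->
  universal_groebner I ('X_[u] - 'X_[v] : S).
Proof.
move=> eqd ne circ; set P := fun k => _; set le := elim_le _ => le_vu.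
have ord : term_order le := elim_term_order _.
have inP (w m : 'X_{1..N}) : (forall k, w k != 0%N -> P k) -> le m w ->
    forall k, m k != 0%N -> P k.
  move=> wP le_mw; have w0 : outer_weight P w == 0%N.
    by rewrite outer_weight_eq0; apply/forallP => k; apply/implyP/wP.
  have : outer_weight P m == 0%N.
    by move: le_mw; rewrite /le /elim_le (eqP w0) ltn0 => /andP[].
  by rewrite outer_weight_eq0 => /forallP m0 k; apply/implyP.
have uP k : u k != 0%N -> P k by rewrite /P => ->.
have vP k : v k != 0%N -> P k by move=> vk; apply/orP; right.
have sv : standard A le v.
  apply/(standardP A_neq0) => m' dm'.
  have /orP[//|le_m'v] := tle_total ord v m'.
  have [-> | ne'] := eqVneq m' v; first exact: tle_refl.
  case: (circ v m') => //; first by rewrite eq_sym.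
  - by move=> k /orP[/vP|/(inP _ _ vP le_m'v)].
  - by case=> /(tdeg_dvd_eq A_neq0) /(_ eqd) /eqP; rewrite (negPf ne).
  by case=> _ /(tdeg_dvd_eq A_neq0) <- //; rewrite eqd.
have nsu : ~~ standard A le u.
  apply: contraNN ne => su; apply/eqP.
  exact: (standard_uniq A_neq0 ord su sv eqd).
have cu : corner A le u.
  rewrite /corner nsu; apply/forallP => k; apply/implyP => uk0.
  set w := (u - U_(k))%MM; have le_wu : (w <= u)%MM := lem_subr _ _.
  have nle_uw : ~ (u <= w)%MM.
    move/mnm_lepP/(_ k); rewrite mnmBE mnm1E eqxx subn1.
    by case: (u k) uk0 => // j _; rewrite ltnn.
  have nle_vw : ~ (v <= w)%MM.
    move=> /lepm_trans /(_ le_wu) /(tdeg_dvd_eq A_neq0) /(_ (esym eqd)) /eqP.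
    by rewrite eq_sym (negPf ne).
  have wP j : w j != 0%N -> P j.
    rewrite -lt0n => lt_j; apply/uP; rewrite -lt0n.
    exact: leq_trans lt_j (mnm_lepP le_wu j).
  apply/(standardP A_neq0) => m' dm'.
  have /orP[//|le_m'w] := tle_total ord w m'.
  have [-> | ne'] := eqVneq m' w; first exact: tle_refl.
  case: (circ w m') => //; first by rewrite eq_sym.
  - by move=> j /orP[/wP|/(inP _ _ wP le_m'w)].
  - by case.
  - by case.
have [m cm|B redB inB] := @reduced_groebner_exists _ _ _ A_neq0 _ ord _ _ toricI D.
  have [m' /andP[sm' /eqP dm']] := standard_rep A_neq0 ord m.
  exact: C_bound (corner_circuit ord cm sm' dm').
by exists le, B; split=> //; apply: inB.
Qed.

(** The universal Groebner basis lies between the set of circuits and the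
    Graver basis, so it is determined as soon as the two coincide. *)
Theorem universal_groebner_circuits f :
  up_to_sign (universal_groebner I) f <->
  up_to_sign (fun g => exists u v, C u v /\ g = 'X_[u] - 'X_[v]) f.
Proof.
have ub g : universal_groebner I g -> exists u v, C u v /\ g = 'X_[u] - 'X_[v].
  case=> le [B [ord redB gB]].
  have [m [m' [cm sm' dm' ->]]] := reduced_groebner_elt A_neq0 ord toricI redB gB.
  by exists m, m'; split=> //; apply: corner_circuit ord cm sm' dm'.
have lb u v : C u v -> up_to_sign (universal_groebner I) ('X_[u] - 'X_[v] : S).
  move=> Cuv; pose P k := (u k != 0%N) || (v k != 0%N).
  have /orP[le_vu|le_uv] := tle_total (elim_term_order P) v u.
    left; apply: circuit_universal (C_deg Cuv) (C_neq Cuv) _ le_vu => m m'.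
    exact: C_circuit.
  right; rewrite opprB; apply: circuit_universal.
  - by rewrite (C_deg Cuv).
  - by rewrite eq_sym C_neq.
  - move=> m m' eqd ne sup; rewrite or_comm; apply: C_circuit => // k.
    by move=> /sup; rewrite orbC.
  - have eq_w m : outer_weight (fun k => (v k != 0%N) || (u k != 0%N)) m
        = outer_weight P m by apply: eq_bigl => k; rewrite /P orbC.
    by move: le_uv; rewrite /elim_le !eq_w.
split=> [[/ub h | /ub h] | [] [u [v [Cuv def_f]]]]; [by left | by right | |].
- by rewrite def_f; apply: lb.
- by rewrite -[f]opprK def_f; case: (lb _ _ Cuv); [right|left]; rewrite ?opprK.
Qed.

End CircuitBasis.

(** * Circulations and cycles of bipartite graphs *)

(** A walk along the positive arcs never gets stuck, since a vertex that is
    entered with a positive value is also left with one. *)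
Lemma circulation_cycle (V : finType) (y : V -> V -> int) (a b : V) :
    (forall u v, y u v = - y v u) -> (forall u, \sum_v y u v = 0) ->
    0 < y a b ->
  exists2 c : seq V, c != [::] & ucycle (fun u v => 0 < y u v) c.
Proof.
move=> anti div0 ab.
have out u v : 0 < y u v -> exists w, 0 < y v w.
  move=> uv; apply/existsP; apply: contraTT uv; rewrite negb_exists => /forallP y_le0.
  rewrite anti oppr_gt0 -leNgt; have := div0 v.
  have nneg w : true -> 0 <= - y v w by rewrite oppr_ge0 leNgt y_le0.
  move/eqP; rewrite -oppr_eq0 -sumrN => /eqP /(psumr_eq0P nneg) /(_ u isT) /eqP.
  by rewrite oppr_eq0 => /eqP ->.
pose f u := odflt u [pick v | 0 < y u v].
have fP u : (exists v, 0 < y u v) -> 0 < y u (f u).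
  by case=> v uv; rewrite /f; case: pickP => //= /(_ v); rewrite uv.
have iter_pos i : 0 < y (iter i f a) (f (iter i f a)).
  elim: i => [|i IHi] /=; first by apply: fP; exists b.
  by apply: fP; apply: out IHi.
have /loopingP/(_ (order f a)) /trajectP[i lt_i eq_i] := looping_order f a.
pose x := iter i f a; have [n def_n] : exists n, order f a = (i + n.+1)%N.
  by exists (order f a - i).-1; rewrite prednK ?subn_gt0 // subnKC // ltnW.
have uniq_c : uniq (traject f x n.+1).
  have := drop_uniq i (orbit_uniq f a); rewrite /orbit def_n.
  by rewrite trajectD drop_size_cat ?size_traject.
exists (traject f x n.+1) => //; apply/andP; split=> //.
have cyc : fcycle f (traject f x n.+1).
  rewrite trajectS /cycle; set s := rcons _ _.
  have -> : s = traject f (f x) n.+1; last exact: fpath_traject.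
  by rewrite trajectSr -iterSr /s /x -iterD addnC -def_n eq_i.
have pos : all (fun u => 0 < y u (f u)) (traject f x n.+1).
  by apply/allP => _ /trajectP[j _ ->]; rewrite /x -iterD iter_pos.
by apply: (sub_in_cycle _ pos cyc) => u v uv _ /eqP <-.
Qed.

Lemma big_parity (R : Type) (idx : R) (op : Monoid.com_law idx) (F : nat -> R)
    (h : nat) (e : bool) :
  \big[op/idx]_(i < h.*2 | odd i == e) F i = \big[op/idx]_(j < h) F (j.*2 + e)%N.
Proof.
elim: h => [|h IHh]; first by rewrite !big_ord0.
rewrite doubleS big_mkcond !big_ord_recr -big_mkcond IHh /= odd_double.
by case: e {IHh} => /=; rewrite Monoid.mulm1 ?addn0 ?addn1.
Qed.

Section CycleNext.
Variables (T : eqType) (c : seq T).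
Hypothesis uniq_c : uniq c.

Lemma perm_map_next : perm_eq (map (next c) c) c.
Proof.
apply: uniq_perm => //.
  by rewrite map_inj_in_uniq // => x z _ _ /(can_inj (prev_next uniq_c)).
move=> x; apply/mapP/idP => [[z zc ->]|xc]; first by rewrite mem_next.
by exists (prev c x); rewrite ?mem_prev ?next_prev.
Qed.

(** The iterates of [next c] reach the whole cycle. *)
Lemma next_const (T' : Type) (g : T -> T') :
  {in c, forall x, g (next c x) = g x} -> {in c &, forall x z, g x = g z}.
Proof.
move=> gn x z xc zc; have [i s def_c] := rot_to xc.
have cyc : fpath (next c) x s.
  have: fcycle (next c) (rot i c) by rewrite rot_cycle cycle_next.
  by rewrite def_c /= rcons_path => /andP[].
have: z \in x :: s by rewrite -def_c mem_rot.
have sub_s : {subset s <= c} by move=> w ws; rewrite -(mem_rot i) def_c inE ws orbT.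
elim: s x xc cyc sub_s {def_c} => [|w s IHs] x xc /=.
  by move=> _ _; rewrite inE => /eqP ->.
case/andP => /eqP def_w cyc sub_s; rewrite inE => /predU1P[-> //|zws].
rewrite -gn // def_w; apply: IHs => //; first by rewrite -def_w mem_next.
by move=> r rs; rewrite sub_s // inE rs orbT.
Qed.

Lemma next_next_neq x : (2 < size c)%N -> x \in c -> next c (next c x) != x.
Proof.
move=> gt2 xc; have [i s def_c] := rot_to xc.
have uniq_s : uniq (x :: s) by rewrite -def_c rot_uniq.
have size_s : (1 < size s)%N.
  by rewrite -ltnS -[X in (_ < X)%N]/(size (x :: s)) -def_c size_rot.
rewrite -!(next_rot i uniq_c) def_c.
case: s {def_c} size_s uniq_s => [|z [|r s]] //= _.
rewrite !inE !negb_or -!andbA => /and5P[xz xr _ zr _].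
by rewrite eqxx (eq_sym z) (negPf xz) /= eqxx eq_sym.
Qed.

Lemma next_nth_rot x0 i :
  (i < size c)%N -> next c (nth x0 c i) = nth x0 (rot 1 c) i.
Proof.
move=> lt_i; rewrite next_nth mem_nth //; case: c uniq_c lt_i => // x s uniq_s lt_i.
rewrite index_uniq // rot1_cons nth_rcons.
have [lt_is|ge_is] := ltnP; first exact: set_nth_default.
rewrite nth_default // ifT // eqn_leq ge_is andbT -ltnS; exact: lt_i.
Qed.

End CycleNext.

Lemma cycle_nonempty (T : finType) (G : simple_graph T) c :
  is_cycle G c -> exists w, w \in c.
Proof. by case; case: c => // w s _ _; exists w; rewrite mem_head. Qed.

(** * The toric ideal of a bipartite graph *)

Section BipartiteGraph.
Variables (V : finType) (G : simple_graph V) (N : nat).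
Variables (ev : V -> V -> 'I_N) (chi : V -> bool).
Hypothesis ev_sym : forall u v, adj G u v -> ev u v = ev v u.
Hypothesis ev_inj : forall u v u' v', adj G u v -> adj G u' v' ->
  ev u v = ev u' v' -> u = u' /\ v = v' \/ u = v' /\ v = u'.
Hypothesis ev_surj : forall k, exists u v, adj G u v /\ ev u v = k.
Hypothesis chi_adj : forall u v, adj G u v -> chi v = ~~ chi u.
Implicit Types (m : 'X_{1..N}) (u v w : V) (c : seq V) (b : bool).

(** The monomial y_u y_v, where u and v are the ends of the edge numbered k. *)
Definition incidence (k : 'I_N) : 'X_{1..#|V|} :=
  [multinom ([exists v, adj G (enum_val j) v && (ev (enum_val j) v == k)] : nat)
    | j < #|V|].

Definition vdeg m w := (\sum_(v | adj G w v) m (ev w v))%N.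

(** The colour of the origin fixes the orientation of an edge. *)
Lemma ev_inj_chi u v u' v' : adj G u v -> adj G u' v' -> chi u = chi u' ->
  ev u v = ev u' v' -> u = u' /\ v = v'.
Proof.
move=> uv uv' eq_chi /(ev_inj uv uv') [//|[eq_u eq_v]].
by move: eq_chi; rewrite eq_u (chi_adj uv'); case: (chi u').
Qed.

Lemma ev_injr w v v' : adj G w v -> adj G w v' -> ev w v = ev w v' -> v = v'.
Proof. by move=> wv wv' /(ev_inj_chi wv wv' erefl) []. Qed.

Lemma incidence_neq0 k : incidence k != 0%MM.
Proof.
have [u [v [uv <-]]] := ev_surj k.
apply/eqP => /mnmP /(_ (enum_rank u)); rewrite mnm0E mnmE enum_rankK.
by case: existsP => //; case; exists v; rewrite uv eqxx.
Qed.

Lemma tdeg_incidence m w : tdeg incidence m (enum_rank w) = vdeg m w.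
Proof.
rewrite tdegE /vdeg; under eq_bigr do rewrite mnmE enum_rankK.
rewrite (partition_big (ev w) xpredT) //=; apply: eq_bigr => k _.
case: existsP => [[v /andP[wv /eqP ev_k]] | no_v].
  rewrite mul1n (big_pred1 v) ?ev_k // => v'.
  apply/andP/eqP => [[wv' /eqP]|->]; last by rewrite ev_k eqxx.
  by rewrite -ev_k; apply: ev_injr.
by rewrite mul0n big_pred0 // => v; apply/negP => wv; case: no_v; exists v.
Qed.

Lemma tdeg_incidenceP m m' :
  tdeg incidence m = tdeg incidence m' <-> vdeg m =1 vdeg m'.
Proof.
split=> [eqd w | eqd]; first by rewrite -!tdeg_incidence eqd.
by apply/mnmP => j; rewrite -(enum_valK j) !tdeg_incidence.
Qed.

Lemma vdeg_edge u v w : adj G u v ->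
  vdeg U_(ev u v) w = ((w == u) + (w == v))%N.
Proof.
move=> uv; have ne_uv : u != v by apply: contraTneq uv => ->; rewrite adj_irr.
rewrite /vdeg; under eq_bigr do rewrite mnm1E.
have one x y : adj G x y -> (\sum_(v' | adj G x v') (ev x y == ev x v') = 1)%N.
  move=> xy; rewrite (bigD1 y) //= eqxx big1 // => v' /andP[xv' ne].
  by apply/eqP; rewrite eqb0; apply: contraNN ne => /eqP /(ev_injr xy xv') ->.
case: eqVneq => [->|ne_wu]; first by rewrite one // (negPf ne_uv).
case: eqVneq => [->|ne_wv]; first by rewrite ev_sym // one // adj_sym.
rewrite big1 // => v' wv'; apply/eqP; rewrite eqb0; apply/negP => /eqP.
by move/(ev_inj uv wv') => [[eq_u _]|[_ eq_v]];
  [move: ne_wu | move: ne_wv]; rewrite ?eq_u ?eq_v eqxx.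
Qed.

(** ** The two monomials of a cycle *)

(** As the colours alternate along a cycle, the edges leaving the vertices of
    colour b are every other edge of the cycle. *)
Definition cycle_mon c b : 'X_{1..N} :=
  (\sum_(w <- c | chi w == b) U_(ev w (next c w)))%MM.

Section Cycle.
Variable c : seq V.
Hypothesis cyc : is_cycle G c.

Let gt2 : (2 < size c)%N. Proof. by case: cyc. Qed.
Let uniq_c : uniq c. Proof. by case: cyc => _ /andP[]. Qed.

Lemma adj_next w : w \in c -> adj G w (next c w).
Proof. by case: cyc => _ /andP[cyc_c _]; apply: next_cycle. Qed.

Lemma cycle_monE b k :
  cycle_mon c b k = (\sum_(w <- c | chi w == b) (ev w (next c w) == k))%N.
Proof. by rewrite mnm_sumE; under eq_bigr do rewrite mnm1E. Qed.

Lemma cycle_mon_supp b k : cycle_mon c b k != 0%N ->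
  exists w, [/\ w \in c, chi w = b & ev w (next c w) = k].
Proof.
rewrite cycle_monE.
case: (boolP (has (fun w => (chi w == b) && (ev w (next c w) == k)) c)).
  by case/hasP => w wc /andP[/eqP ? /eqP ?]; exists w.
move=> /hasPn none; rewrite big_seq_cond big1 // => w /andP[wc cw].
by have := none w wc; rewrite cw /= => /negPf ->.
Qed.

(** The edges leaving the vertices of one colour are distinct, so that each of
    their variables occurs only once in the monomial. *)
Lemma cycle_mon_dvd b m :
  {in c, forall w, chi w = b -> (0 < m (ev w (next c w)))%N} ->
  (cycle_mon c b <= m)%MM.
Proof.
move=> pos; apply/mnm_lepP => k.
case: (eqVneq (cycle_mon c b k) 0%N) => [-> //|/cycle_mon_supp[w [wc cw <-]]].
rewrite cycle_monE big_mkcond (bigD1_seq w) //= cw !eqxx big_seq_cond big1 ?addn0.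
  exact: pos.
move=> w' /andP[w'c ne]; case: eqP => // cw'; apply/eqP; rewrite eqb0.
apply: contraNN ne => /eqP /ev_inj_chi [] //; try exact: adj_next.
  by rewrite cw'.
by move=> ->.
Qed.

Lemma cycle_mon_gt0 w : w \in c -> (0 < cycle_mon c (chi w) (ev w (next c w)))%N.
Proof. by move=> wc; rewrite cycle_monE (big_rem w) //= !eqxx. Qed.

(** An edge leaving vertices of both colours would be traversed twice, which
    needs a cycle of length 2. *)
Lemma cycle_mon_neq : cycle_mon c true != cycle_mon c false.
Proof.
have [w wc] := cycle_nonempty cyc.
have := cycle_mon_gt0 wc.
suff : ~~ (0 < cycle_mon c (~~ chi w) (ev w (next c w)))%N.
  by case: (chi w) => /= h1 h2; apply/eqP => e; move: h1; rewrite ?e ?h2 // -e h2.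
apply/negP; rewrite lt0n => /cycle_mon_supp[w' [w'c cw']].
case/ev_inj; try exact: adj_next.
  by case=> eq_w _; move: cw'; rewrite eq_w; case: (chi w).
by case=> eq_w' /eqP; rewrite eq_w' (negPf (next_next_neq _ _ _)).
Qed.

(** Each vertex of the cycle is the origin of one edge and the end of another, of
    opposite colours; so it has degree 1 in both monomials. *)
Lemma vdeg_cycle_mon b w : vdeg (cycle_mon c b) w = (\sum_(x <- c) (w == x))%N.
Proof.
have -> : vdeg (cycle_mon c b) w
    = (\sum_(x <- c | chi x == b) ((w == x) + (w == next c x)))%N.
  rewrite /vdeg; under eq_bigr do rewrite mnm_sumE.
  rewrite exchange_big /= !(big_seq_cond (fun x => chi x == b)).
  by apply: eq_bigr => x /andP[xc _]; apply/vdeg_edge/adj_next.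
rewrite big_split /= [RHS](bigID (fun x => chi x == b)) /=; congr (_ + _)%N.
rewrite -[RHS](perm_big _ (perm_map_next uniq_c)) /= big_map.
rewrite big_seq_cond [RHS]big_seq_cond; apply: eq_bigl => x.
by case xc: (x \in c) => //=; rewrite (chi_adj (adj_next xc)); case: (chi x); case: b.
Qed.

Lemma color_rot1 x0 i : (i < size c)%N ->
  chi (nth x0 (rot 1 c) i) = ~~ chi (nth x0 c i).
Proof.
by move=> lt_i; rewrite -next_nth_rot // (chi_adj (adj_next _)) // mem_nth.
Qed.

Lemma cycle_color x0 i : (i < size c)%N ->
  chi (nth x0 c i) = chi (nth x0 c 0) (+) odd i.
Proof.
elim: i => [|i IHi] lt_i; first by rewrite addbF.
have := color_rot1 x0 (ltnW lt_i); rewrite IHi 1?ltnW // => rot_i.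
have -> : nth x0 c i.+1 = nth x0 (rot 1 c) i.
  by case: c lt_i => // x s lt_i; rewrite rot1_cons nth_rcons -ltnS lt_i.
by rewrite rot_i /= addbN.
Qed.

Lemma cycle_even : ~~ odd (size c).
Proof.
have [x0 _] := cycle_nonempty cyc.
have lt_p : ((size c).-1 < size c)%N by rewrite prednK // (ltn_trans _ gt2).
have := color_rot1 x0 lt_p; rewrite (cycle_color _ lt_p).
have -> : nth x0 (rot 1 c) (size c).-1 = nth x0 c 0.
  by case: c gt2 => // x s _; rewrite rot1_cons nth_rcons ltnn eqxx.
have -> : odd (size c) = ~~ odd (size c).-1 by case: (size c) gt2.
by case: (odd _); case: (chi _).
Qed.

(** Colours and positions have the same parity, up to the colour of the first
    vertex. *)
Lemma cycle_mon_half x0 e :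
  cycle_mon c (chi (nth x0 c 0) (+) e) =
  (\sum_(j < (size c)./2)
     U_(ev (nth x0 c (j.*2 + e)) (nth x0 (rot 1 c) (j.*2 + e))))%MM.
Proof.
rewrite -(big_parity _ (fun i => U_(ev (nth x0 c i) (nth x0 (rot 1 c) i)))%MM).
rewrite halfK (negPf cycle_even) subn0 /cycle_mon (big_nth x0) big_mkord.
apply: eq_big => [i|i _]; last by rewrite next_nth_rot.
by rewrite cycle_color //; case: (chi _); case: (odd i); case: e.
Qed.

Lemma mdeg_cycle_mon b : (mdeg (cycle_mon c b) <= #|V|)%N.
Proof.
rewrite mdeg_sum big_mkcond /=; apply: leq_trans (_ : size c <= _)%N.
  rewrite -sum1_size; apply: leq_sum => w _; case: ifP => // _.
  by rewrite mdeg1.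
by rewrite -(card_uniqP uniq_c) max_card.
Qed.

End Cycle.

(** ** The flow of a binomial *)

Section Flow.
Variables m m' : 'X_{1..N}.

(** Orienting the positive edges of m - m' from colour true to colour false and the
    negative ones backwards turns the equality of degrees into a
    conservation law. *)
Definition flow u v : int :=
  if adj G u v then
    (if chi u then 1 else -1) * ((m (ev u v))%:Z - (m' (ev u v))%:Z)
  else 0.

Lemma flow_anti u v : flow u v = - flow v u.
Proof.
rewrite /flow [adj G v u]adj_sym; case: ifP => uv; last by rewrite oppr0.
rewrite (chi_adj uv) (ev_sym uv).
by case: (chi u); rewrite ?mulN1r ?mul1r ?opprK.
Qed.

Lemma flow_div : vdeg m =1 vdeg m' -> forall u, \sum_v flow u v = 0.
Proof.
move=> eqd u; rewrite /flow -big_mkcond /= -mulr_sumr sumrB.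
by rewrite -!(big_morph Posz PoszD (erefl _)) -!/(vdeg _ _) eqd subrr mulr0.
Qed.

Lemma flow_gt0_dvd c : is_cycle G c ->
    {in c, forall w, 0 < flow w (next c w)} ->
  (cycle_mon c true <= m)%MM /\ (cycle_mon c false <= m')%MM.
Proof.
move=> cyc pos; split; apply: cycle_mon_dvd => // w wc cw; have := pos w wc;
  rewrite /flow (adj_next cyc wc) cw ?mul1r ?mulN1r ?opprB subr_gt0;
  by rewrite ltz_nat; apply: leq_ltn_trans.
Qed.

Lemma flow_lt0_dvd c : is_cycle G c ->
    {in c, forall w, flow w (next c w) < 0} ->
  (cycle_mon c false <= m)%MM /\ (cycle_mon c true <= m')%MM.
Proof.
move=> cyc neg; split; apply: cycle_mon_dvd => // w wc cw; have := neg w wc;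
  rewrite /flow (adj_next cyc wc) cw ?mul1r ?mulN1r ?opprB subr_lt0;
  by rewrite ltz_nat; apply: leq_ltn_trans.
Qed.

(** A directed cycle of the flow has an edge with m > m' at each vertex of colour
    true and one with m < m' at each vertex of colour false. *)
Lemma flow_conformal : vdeg m =1 vdeg m' -> m != m' ->
  exists c, [/\ is_cycle G c, (cycle_mon c true <= m)%MM
              & (cycle_mon c false <= m')%MM].
Proof.
move=> eqd ne.
have [u [v pos_uv]] : exists u v, 0 < flow u v.
  have [k ne_k] : exists k, m k != m' k.
    apply/existsP; apply: contraNT ne; rewrite negb_exists => /forallP eq_m.
    by apply/eqP/mnmP => k; apply/eqP; rewrite -[_ == _]negbK eq_m.
  have [u [v [uv def_k]]] := ev_surj k.
  have : flow u v != 0.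
    rewrite /flow uv def_k mulf_neq0 //; first by case: (chi u).
    by rewrite subr_eq0.
  rewrite neq_lt => /orP[lt0|]; last by exists u, v.
  by exists v, u; rewrite flow_anti oppr_gt0.
have [c c0 /andP[cyc_c uniq_c]] :=
  circulation_cycle flow_anti (flow_div eqd) pos_uv => {u v pos_uv}.
have pos_next : {in c, forall w, 0 < flow w (next c w)}.
  by move=> w wc; apply: (next_cycle cyc_c).
have nrefl u : 0 < flow u u = false by rewrite /flow adj_irr.
have asym u v : 0 < flow u v -> 0 < flow v u -> False.
  by move=> uv; rewrite flow_anti oppr_gt0 => /(lt_trans uv); rewrite ltxx.
have cyc : is_cycle G c.
  split; last first.
    apply/andP; split=> //; apply: sub_cycle cyc_c => u v.
    by rewrite /flow; case: (adj G u v) => //; rewrite ltxx.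
  case: c c0 cyc_c {uniq_c pos_next} => [|u [|v [|w s]]] //= _.
    by rewrite nrefl.
  by case/and3P => uv vu _; case: (asym u v).
by exists c; have [] := flow_gt0_dvd cyc pos_next.
Qed.

(** When the flow lives on a single cycle, conservation makes it constant. *)
Lemma flow_circuit c : is_cycle G c -> vdeg m =1 vdeg m' -> m != m' ->
    (forall k, (m k != 0%N) || (m' k != 0%N) ->
       (cycle_mon c true k != 0%N) || (cycle_mon c false k != 0%N)) ->
  (cycle_mon c true <= m)%MM /\ (cycle_mon c false <= m')%MM \/
  (cycle_mon c false <= m)%MM /\ (cycle_mon c true <= m')%MM.
Proof.
move=> cyc eqd ne sup.
have [gt2 /andP[cyc_c uniq_c]] := cyc.
have supp k : (m k != 0%N) || (m' k != 0%N) ->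
    exists2 w, w \in c & ev w (next c w) = k.
  by move/sup/orP => [] /(cycle_mon_supp) [w [wc _ ek]]; exists w.
have flow_supp u v : flow u v != 0 ->
    u \in c /\ (v = next c u \/ u = next c v).
  rewrite /flow; case: ifP => uv; last by rewrite eqxx.
  have [/andP[/eqP -> /eqP ->]|] :=
      boolP ((m (ev u v) == 0%N) && (m' (ev u v) == 0%N)).
    by rewrite subrr mulr0 eqxx.
  rewrite negb_and => /supp[w wc def_k] _.
  have [[<- <-]|[<- <-]] := ev_inj (adj_next cyc wc) uv def_k.
    by split=> //; left.
  by rewrite mem_next; split=> //; right.
pose g w := flow w (next c w).
have gn : {in c, forall w, g (next c w) = g w}.
  move=> w wc; set x := next c w; have := flow_div eqd x.
  have ne_w : next c x != w := next_next_neq uniq_c gt2 wc.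
  rewrite (bigD1 (next c x)) //= (bigD1 w) ?big1 //= 1?eq_sym //.
    rewrite addr0 => /eqP; rewrite addr_eq0 => /eqP.
    by rewrite [flow x w]flow_anti opprK.
  move=> v /andP[ne_v ne_vw]; apply/eqP; apply: contraT => /flow_supp[_ [eq_v|eq_x]].
    by rewrite eq_v eqxx in ne_v.
  by rewrite -(prev_next uniq_c v) -eq_x prev_next // eqxx in ne_vw.
have g_const := next_const uniq_c gn.
have [w0 w0c] := cycle_nonempty cyc.
have [lt0|gt0|g0] := ltgtP (g w0) 0.
- by right; apply: flow_lt0_dvd => // w wc; rewrite -/(g w) (g_const w w0).
- by left; apply: flow_gt0_dvd => // w wc; rewrite -/(g w) (g_const w w0).
case/eqP: ne; apply/mnmP => k.
have [/andP[/eqP -> /eqP -> //]|] := boolP ((m k == 0%N) && (m' k == 0%N)).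
rewrite negb_and => /supp[w wc <-]; have /eqP := g_const w w0 wc w0c.
rewrite g0 /g /flow (adj_next cyc wc) mulf_eq0 subr_eq0 => /orP[|/eqP[] //].
by case: (chi w).
Qed.

End Flow.

(** The cycles satisfy both hypotheses of the criterion: conformality by
    [flow_conformal], the circuit property by [flow_circuit]. *)
Theorem bipartite_universal_groebner (K : fieldType)
    (I : {mpoly K[N]} -> Prop) (f : {mpoly K[N]}) :
    (forall p, I p <-> toric_map incidence p = 0) ->
  up_to_sign (universal_groebner I) f <->
  up_to_sign (fun g => exists c, is_cycle G c /\
                g = 'X_[cycle_mon c true] - 'X_[cycle_mon c false]) f.
Proof.
move=> toricI.
pose C (s t : 'X_{1..N}) :=
  exists c, [/\ is_cycle G c, s = cycle_mon c true & t = cycle_mon c false].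
have circuits := @universal_groebner_circuits K N #|V| #|V| _ incidence_neq0 I C toricI.
have -> : up_to_sign (universal_groebner I) f <->
    up_to_sign (fun g => exists s t, C s t /\ g = 'X_[s] - 'X_[t]) f.
  apply: circuits => [_ _ [c [cyc -> _]] | _ _ [c [cyc -> ->]]
    | _ _ [c [cyc -> ->]] | m m' | _ _ m m' [c [cyc -> ->]]].
  - exact: mdeg_cycle_mon.
  - by apply/tdeg_incidenceP => w; rewrite !vdeg_cycle_mon.
  - exact: cycle_mon_neq.
  - move=> /tdeg_incidenceP eqd ne; have [c [cyc le_t le_f]] := flow_conformal eqd ne.
    by exists (cycle_mon c true), (cycle_mon c false); split=> //; exists c.
  - by move=> /tdeg_incidenceP eqd ne; apply: flow_circuit.
have E g : (exists s t, C s t /\ g = 'X_[s] - 'X_[t]) <->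
    exists c, is_cycle G c /\ g = 'X_[cycle_mon c true] - 'X_[cycle_mon c false].
  split=> [[_ [_ [[c [cyc -> ->]] ->]]]|[c [cyc ->]]]; first by exists c.
  by exists (cycle_mon c true), (cycle_mon c false); split=> //; exists c.
by rewrite /up_to_sign !E.
Qed.

End BipartiteGraph.

(** * Edge cuts and colourings of forests *)

Section Forest.
Variables (n : nat) (G : simple_graph 'I_n).
Hypothesis acyclic : forall c, ~ is_cycle G c.
Implicit Types (a b u v : 'I_n).

Definition cut_edge a b : rel 'I_n := fun u v =>
  adj G u v && ~~ ((u == a) && (v == b) || (u == b) && (v == a)).

Definition side a b u := connect (cut_edge a b) a u.

(** A path from a to b avoiding the edge {a, b} would close up to a cycle. *)
Lemma side_other a b : adj G a b -> ~~ side a b b.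
Proof.
move=> ab; apply/negP => /connectP[p0 path_p0 last_p0].
case/shortenP: path_p0 last_p0 => p path_p uniq_p _ def_b.
apply: (acyclic (c := a :: p)); split; last first.
  apply/andP; split=> //; rewrite /cycle rcons_path -def_b adj_sym ab andbT.
  by apply: sub_path path_p => u v /andP[].
case: p path_p def_b {uniq_p} => [_ /= eq_ba | x [|z p]] //=.
  by rewrite -eq_ba adj_irr in ab.
by rewrite andbT => cut_ax eq_bx; rewrite /cut_edge -eq_bx !eqxx andbF in cut_ax.
Qed.

Lemma side_step a b u v : adj G u v ->
  ~~ ((u == a) && (v == b) || (u == b) && (v == a)) -> side a b u = side a b v.
Proof.
move=> uv ne; have step x z : cut_edge a b x z -> side a b x -> side a b z.
  by move=> xz ax; apply: connect_trans ax (connect1 xz).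
apply/idP/idP; apply: step; rewrite /cut_edge ?uv //= adj_sym uv /=.
by apply: contraNN ne => /orP[] /andP[/eqP -> /eqP ->]; rewrite !eqxx ?orbT.
Qed.

(** Crossing an edge changes the side for that edge only, so the parity of the
    number of edges having u on their first side is a 2-colouring. *)
Definition forest_color u :=
  \big[addb/false]_(e : 'I_n * 'I_n | (e.1 < e.2)%N && adj G e.1 e.2)
    side e.1 e.2 u.

Lemma forest_color_adj u v :
  adj G u v -> forest_color v = ~~ forest_color u.
Proof.
wlog lt_uv : u v / (u < v)%N => [wlog_lt uv|uv].
  case: (ltngtP u v) => [lt|lt|eq]; first exact: wlog_lt.
    by rewrite (wlog_lt v u) ?negbK // adj_sym.
  by move: uv; rewrite (ord_inj eq) adj_irr.
rewrite /forest_color (bigD1 (u, v)) ?lt_uv //= [in RHS](bigD1 (u, v)) ?lt_uv //=.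
rewrite (negPf (side_other uv)) [side u v u]connect0 negbK /=.
apply: eq_bigr => -[a b] /= /andP[/andP[lt_ab _] ne]; apply/esym/side_step => //.
apply: contraNN ne => /orP[] /andP[/eqP eq_u /eqP eq_v].
  by rewrite eq_u eq_v.
by move: lt_uv; rewrite eq_u eq_v ltnNge ltnW.
Qed.

(** With signs given by the colouring, the equations at the vertices on one side
    of an edge add up to the value on that edge, up to sign: the two
    contributions of any edge within that side cancel out. *)
Lemma forest_no_flow (t : 'I_n -> 'I_n -> int) :
    (forall u v, t u v = t v u) -> (forall u v, ~~ adj G u v -> t u v = 0) ->
    (forall u, \sum_v t u v = 0) ->
  forall u v, t u v = 0.
Proof.
move=> symt supt bal a b.
have [ab|/supt //] := boolP (adj G a b).
pose s u : int := if side a b u then (if forest_color u then 1 else -1) else 0.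
have sum0 : \sum_u \sum_v (s u + s v) * t u v = 0.
  under eq_bigr => u _ do
    (under eq_bigr => v _ do rewrite mulrDl;
     rewrite big_split /= -mulr_sumr bal mulr0 add0r).
  rewrite exchange_big /= big1 // => v _; under eq_bigr do rewrite symt.
  by rewrite -mulr_sumr bal mulr0.
have ne_ab : a != b by apply: contraTneq ab => ->; rewrite adj_irr.
have sb : s b = 0 by rewrite /s (negPf (side_other ab)).
have vanish u v : ~~ ((u == a) && (v == b) || (u == b) && (v == a)) ->
    (s u + s v) * t u v = 0.
  move=> ne; have [uv|/supt ->] := boolP (adj G u v); last by rewrite mulr0.
  rewrite /s -(side_step uv ne) (forest_color_adj uv).
  by case: ifP; case: (forest_color u); rewrite ?addrN ?addNr ?addr0 mul0r.
have := sum0; rewrite (bigD1 a) //= (bigD1 b) //= sb addr0 big1 ?addr0; last first.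
  by move=> v ne_vb; rewrite vanish // (negPf ne_vb) andbF (negPf ne_ab).
rewrite (bigD1 b) 1?eq_sym //= (bigD1 a) //= sb add0r big1 ?addr0; last first.
  move=> v ne_va; rewrite -[X in X + s v]sb vanish // (negPf ne_va) andbF.
  by rewrite eq_sym (negPf ne_ab).
rewrite big1 ?addr0; last first.
  move=> u /andP[ne_ua ne_ub]; apply: big1 => v _.
  by rewrite vanish // (negPf ne_ua) (negPf ne_ub).
rewrite [t b a]symt -mulrDl => /eqP; rewrite mulf_eq0 => /orP[|/eqP //].
by rewrite /s [side a b a]connect0; case: (forest_color a).
Qed.

End Forest.

(** * The prism of a tree *)

Section Prism.
Variables (n : nat) (G : simple_graph 'I_n).
Hypothesis acyclic : forall c, ~ is_cycle G c.
Local Notation V := ('I_n + 'I_n)%type.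
Local Notation N := #|var G|.
Implicit Types (i j : 'I_n) (u v : V) (m : 'X_{1..N}).

Lemma diag_var i : ((i, i).1 == (i, i).2) || adj G (i, i).1 (i, i).2.
Proof. by rewrite /= eqxx. Qed.

(** The default value, the index of x_ii, is taken for the pairs that index no
    variable. *)
Definition var_idx i j : 'I_N :=
  enum_rank (insubd (Sub (i, i) (diag_var i) : var G) (i, j)).

Lemma var_idxK i j : (i == j) || adj G i j -> val (enum_val (var_idx i j)) = (i, j).
Proof. by move=> ij; rewrite enum_rankK insubdK. Qed.

Lemma var_idx_inj i j i' j' : (i == j) || adj G i j -> (i' == j') || adj G i' j' ->
  var_idx i j = var_idx i' j' -> i = i' /\ j = j'.
Proof.
by move=> ij ij' eq_idx; have := var_idxK ij; rewrite eq_idx var_idxK // => -[-> ->].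
Qed.

Lemma x_var_idx (K : fieldType) i j : (i == j) || adj G i j ->
  x K G i j = 'X_(var_idx i j) :> {mpoly K[N]}.
Proof.
by move=> ij; rewrite /x /var_idx /insubd; case: insubP => //=; rewrite ij.
Qed.

Definition prism_ev u v : 'I_N :=
  match u, v with
  | inl i, inl j => if (i < j)%N then var_idx i j else var_idx j i
  | inr i, inr j => if (i < j)%N then var_idx j i else var_idx i j
  | inl i, inr _ | inr i, inl _ => var_idx i i
  end.

Lemma edge_var_ev (K : fieldType) u v : prism_adj G u v ->
  edge_var K G u v = 'X_(prism_ev u v) :> {mpoly K[N]}.
Proof.
by case: u v => i [] j /= ij; try case: ifP => _;
  rewrite x_var_idx ?eqxx ?ij ?orbT // adj_sym ij orbT.
Qed.

Lemma adj_neq i j : adj G i j -> i != j :> nat.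
Proof. by apply: contraTneq => /ord_inj ->; rewrite adj_irr. Qed.

Lemma prism_ev_sym u v : prism_adj G u v -> prism_ev u v = prism_ev v u.
Proof.
case: u v => i [] j //= ij; try by rewrite (eqP ij).
  by case: ltngtP (adj_neq ij).
by case: ltngtP (adj_neq ij).
Qed.

(** The inverse of the labelling of the edges by variables. *)
Definition var_ends (e : 'I_n * 'I_n) : V * V :=
  if e.1 == e.2 then (inl e.1, inr e.1)
  else if (e.1 < e.2)%N then (inl e.1, inl e.2) else (inr e.1, inr e.2).

Lemma prism_evK u v : prism_adj G u v ->
  let e := var_ends (val (enum_val (prism_ev u v))) in e = (u, v) \/ e = (v, u).
Proof.
case: u v => i [] j /= ij; rewrite /var_ends.
- have ji : adj G j i by rewrite adj_sym.
  have /negPf ne : i != j by apply: contraTneq ij => ->; rewrite adj_irr.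
  case: ltngtP (adj_neq ij) => // lt _; rewrite var_idxK ?ij ?ji ?orbT //=.
    by rewrite ne lt; left.
  by rewrite eq_sym ne lt; right.
- by rewrite var_idxK eqxx //= -(eqP ij); left.
- by rewrite var_idxK eqxx //= -(eqP ij); right.
- have ji : adj G j i by rewrite adj_sym.
  have /negPf ne : i != j by apply: contraTneq ij => ->; rewrite adj_irr.
  case: ltngtP (adj_neq ij) => // lt _; rewrite var_idxK ?ij ?ji ?orbT //=.
    by rewrite eq_sym ne ltnNge (ltnW lt); right.
  by rewrite ne ltnNge (ltnW lt); left.
Qed.

Lemma prism_ev_inj u v u' v' : prism_adj G u v -> prism_adj G u' v' ->
  prism_ev u v = prism_ev u' v' -> u = u' /\ v = v' \/ u = v' /\ v = u'.
Proof.
move=> /prism_evK /= euv /prism_evK /= euv' eq_ev.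
rewrite eq_ev in euv.
by case: euv euv' => -> [] [-> ->]; by [left | right].
Qed.

Lemma prism_ev_surj k : exists u v, prism_adj G u v /\ prism_ev u v = k.
Proof.
case def_e: (enum_val k) => [[i j] ij].
have {def_e} -> : k = enum_rank (exist _ (i, j) ij : var G).
  by rewrite -def_e enum_valK.
rewrite /= in ij *.
have -> : enum_rank (exist _ (i, j) ij : var G) = var_idx i j.
  by apply: enum_val_inj; apply: val_inj; rewrite var_idxK // enum_rankK.
case/orP: ij => [/eqP <-|ij]; first by exists (inl i), (inr i); rewrite /= eqxx.
case: ltngtP (adj_neq ij) => // lt _.
  by exists (inl i), (inl j); rewrite /= lt.
by exists (inr i), (inr j); rewrite /= ltnNge (ltnW lt).
Qed.

(** The two layers of the prism carry opposite colourings of the tree. *)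
Definition prism_color u :=
  match u with inl i => forest_color G i | inr i => ~~ forest_color G i end.

Lemma prism_color_adj u v : prism_adj G u v -> prism_color v = ~~ prism_color u.
Proof.
case: u v => i [] j /= ij; try by rewrite (eqP ij) ?negbK.
  exact: forest_color_adj.
by rewrite (forest_color_adj acyclic ij).
Qed.

Local Notation ev := prism_ev.
Local Notation pdeg := (tdeg (incidence (prism G) ev)).

Lemma pdegP m m' : pdeg m = pdeg m' <-> vdeg (prism G) ev m =1 vdeg (prism G) ev m'.
Proof. exact: (@tdeg_incidenceP _ (prism G) _ ev _ prism_ev_inj prism_color_adj). Qed.

(** Both sides are the sum of the degrees of the four vertices of a square. *)
Lemma square_deg i j : adj G i j ->
  pdeg (U_(var_idx i j) + U_(var_idx j i))%MM
    = pdeg (U_(var_idx i i) + U_(var_idx j j))%MM.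
Proof.
wlog lt_ij : i j / (i < j)%N => [wlog_lt ij|ij].
  case: ltngtP (adj_neq ij) => // lt _; first exact: wlog_lt.
  by rewrite [X in pdeg X]addmC [X in _ = pdeg X]addmC wlog_lt // adj_sym.
have ev_ij : var_idx i j = ev (inl i) (inl j) by rewrite /= lt_ij.
have ev_ji : var_idx j i = ev (inr i) (inr j) by rewrite /= lt_ij.
have ev_d i' : var_idx i' i' = ev (inl i') (inr i') by [].
have vdegD m m' w : vdeg (prism G) ev (m + m')%MM w
    = (vdeg (prism G) ev m w + vdeg (prism G) ev m' w)%N.
  by rewrite /vdeg -big_split; apply: eq_bigr => v _; rewrite mnmDE.
apply/pdegP => w; rewrite !vdegD ev_ij ev_ji (ev_d i) (ev_d j).
pose edgeE := @vdeg_edge _ (prism G) _ ev _ prism_ev_sym prism_ev_inj prism_color_adj.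
rewrite !edgeE //= ?eqxx //.
by lia.
Qed.

Lemma P_square (K : fieldType) m i j : adj G i j ->
  P_ideal K G ('X_[m + (U_(var_idx i j) + U_(var_idx j i))]
               - 'X_[m + (U_(var_idx i i) + U_(var_idx j j))]).
Proof.
wlog lt_ij : i j / (i < j)%N => [wlog_lt ij|ij].
  case: ltngtP (adj_neq ij) => // lt _; first exact: wlog_lt.
  rewrite [(U_(var_idx i j) + _)%MM]addmC [(U_(var_idx i i) + _)%MM]addmC.
  by apply: wlog_lt; rewrite // adj_sym.
have ji : adj G j i by rewrite adj_sym.
rewrite !mpolyXD -mulrBr -[X in _ * X]opprB mulrN -mulNr; apply: ideal_genM.
apply: ideal_gen_in; exists i, j; split=> //.
by rewrite !x_var_idx ?eqxx ?ij ?ji ?orbT.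
Qed.

Section Kernel.
Variables m m' : 'X_{1..N}.
Hypothesis eqd : pdeg m = pdeg m'.
Let z k : int := (m k)%:Z - (m' k)%:Z.

Lemma kernel_balance u : \sum_(v | prism_adj G u v) z (ev u v) = 0.
Proof.
rewrite sumrB -!(big_morph Posz PoszD (erefl _)).
by have /pdegP /(_ u) := eqd; rewrite /vdeg => ->; rewrite subrr.
Qed.

(** The differences between the two copies of each edge of the tree are in
    equilibrium at every vertex of the tree, so they vanish. *)
Lemma kernel_sym i j : adj G i j -> z (var_idx i j) = z (var_idx j i).
Proof.
pose t i j : int :=
  if adj G i j then z (ev (inl i) (inl j)) - z (ev (inr i) (inr j)) else 0.
have t0 : forall i j, t i j = 0.
  apply: (forest_no_flow acyclic) => {i j} [i j|i j|i].
  - rewrite /t adj_sym; case: ifP => // ji.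
    by rewrite (@prism_ev_sym (inl i) (inl j)) 1?(@prism_ev_sym (inr i) (inr j)) //= adj_sym.
  - by rewrite /t => /negPf ->.
  have diag : \sum_(j | i == j) z (var_idx i i) = z (var_idx i i).
    by rewrite (big_pred1 i) // => j; rewrite eq_sym.
  rewrite /t -big_mkcond sumrB.
  have := kernel_balance (inl i); have := kernel_balance (inr i).
  rewrite !big_sumType /= !diag => eq_r eq_l.
  by apply/eqP; rewrite subr_eq0 -(inj_eq (addIr (z (var_idx i i)))) eq_l addrC eq_r.
move=> ij; have := t0 i j; rewrite /t ij /=; case: ifP => _ /eqP.
  by rewrite subr_eq0 => /eqP.
by rewrite subr_eq0 eq_sym => /eqP.
Qed.

(** The degree at p_i and the exponents of its other edges determine the exponent
    of x_ii. *)
Lemma kernel_eq :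
  (forall i j, adj G i j -> m (var_idx i j) = m' (var_idx i j)) -> m = m'.
Proof.
move=> eq_off; have zoff i j : adj G i j -> z (var_idx i j) = 0.
  by move=> ij; rewrite /z eq_off // subrr.
apply/mnmP => k; apply/eqP; rewrite -eqz_nat -subr_eq0 -/(z k).
have [u [v [uv <-]]] := prism_ev_surj k.
have zdiag i : z (var_idx i i) = 0.
  have := kernel_balance (inl i); rewrite big_sumType /= big1 => [|j ij].
    by rewrite add0r (big_pred1 i) // => j; rewrite eq_sym.
  by case: ifP => _; rewrite zoff // adj_sym.
case: u v uv => i [] j /= ij; rewrite ?zdiag //; case: ifP => _;
  by rewrite zoff // adj_sym.
Qed.

End Kernel.

(** The variables x_ii are left out because [P_step] may increase the difference of
    exponents there; by [kernel_eq], on monomials of the same degree the distance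
    still vanishes on the diagonal only. *)
Definition off_dist m m' := (\sum_(e : 'I_n * 'I_n | adj G e.1 e.2)
  ((m (var_idx e.1 e.2) - m' (var_idx e.1 e.2))
   + (m' (var_idx e.1 e.2) - m (var_idx e.1 e.2))))%N.

Lemma off_distC m m' : off_dist m m' = off_dist m' m.
Proof. by apply: eq_bigr => e _; rewrite addnC. Qed.

Lemma P_step (K : fieldType) m m' i j : adj G i j ->
    (m' (var_idx i j) < m (var_idx i j))%N ->
    (m' (var_idx j i) < m (var_idx j i))%N ->
  exists m1, [/\ P_ideal K G ('X_[m] - 'X_[m1]), pdeg m1 = pdeg m
               & (off_dist m1 m' < off_dist m m')%N].
Proof.
move=> ij lt_ij lt_ji; have ji : adj G j i by rewrite adj_sym.
pose sq := (U_(var_idx i j) + U_(var_idx j i))%MM.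
pose dg := (U_(var_idx i i) + U_(var_idx j j))%MM.
have idx_eq a b c d : adj G a b -> (c == d) || adj G c d ->
    (var_idx c d == var_idx a b) = (c == a) && (d == b).
  move=> ab cd; apply/eqP/andP => [/var_idx_inj[] //|[/eqP -> /eqP -> //]].
  by rewrite ab orbT.
  by move=> -> ->.
have sqE a b : adj G a b ->
    sq (var_idx a b) = ((i == a) && (j == b) + (j == a) && (i == b))%N.
  by move=> ab; rewrite mnmDE !mnm1E !idx_eq ?ij ?ji ?orbT.
have ne_ij : i != j by apply: contraTneq ij => ->; rewrite adj_irr.
have le_sq : (sq <= m)%MM.
  have /negPf ne_idx : var_idx j i != var_idx i j.
    by rewrite idx_eq ?ji ?orbT // eq_sym (negPf ne_ij).
  apply/mnm_lepP => k; rewrite mnmDE !mnm1E; case: eqP => [<-|_].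
    by rewrite ne_idx; lia.
  by case: eqP => [<-|_] //; lia.
pose m0 := (m - sq)%MM.
have def_m : m = (m0 + sq)%MM by rewrite submK.
exists (m0 + dg)%MM; split.
- by rewrite {1}def_m; apply: P_square.
- by rewrite [in RHS]def_m [LHS]tdegD [RHS]tdegD square_deg.
have m1E a b : adj G a b ->
    (m0 + dg)%MM (var_idx a b) = (m (var_idx a b) - sq (var_idx a b))%N.
  move=> ab; rewrite mnmDE mnmBE [dg _]mnmDE !mnm1E !idx_eq ?eqxx //.
  have /negPf ne_ab : a != b by apply: contraTneq ab => ->; rewrite adj_irr.
  have off c : (c == a) && (c == b) = false.
    by apply/negP => /andP[/eqP -> eq_ab]; rewrite eq_ab in ne_ab.
  by rewrite !off addn0.
rewrite /off_dist (bigD1 (i, j)) //= [X in (_ < X)%N](bigD1 (i, j)) //=.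
rewrite -addSn leq_add //.
  rewrite m1E // sqE // !eqxx (negPf ne_ij) andbF /=.
  move: lt_ij; set a := m _; set b := m' _ => lt_ab.
  by lia.
apply: leq_sum => -[a b] /= /andP[ab ne_ab]; rewrite m1E // sqE //.
have -> : (i == a) && (j == b) = false.
  by apply: contraNF ne_ab => /andP[/eqP -> /eqP ->].
have [/andP[/eqP <- /eqP <-]|_] := boolP ((j == a) && (i == b)); last by rewrite subn0.
by move: lt_ji; set c := m _; set d := m' _ => lt_cd; lia.
Qed.

(** Exchanging the edges x_ij x_ji of a square for x_ii x_jj moves two monomials
    of a fiber closer to each other. *)
Lemma P_kernel (K : fieldType) m m' :
  pdeg m = pdeg m' -> P_ideal K G ('X_[m] - 'X_[m']).
Proof.
have [d] := ubnP (off_dist m m'); elim: d m m' => // d IHd m m'.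
rewrite ltnS => le_d eqd.
have [/forallP eq_off|] := boolP [forall e : 'I_n * 'I_n,
    adj G e.1 e.2 ==> (m (var_idx e.1 e.2) == m' (var_idx e.1 e.2))].
  rewrite (kernel_eq eqd) ?subrr; first exact: ideal_gen0.
  by move=> i j ij; apply/eqP; have := eq_off (i, j); rewrite /= ij.
move=> /forallPn[[i j]]; rewrite negb_imply /= => /andP[ij ne].
have sym := kernel_sym eqd ij.
have [lt|lt|/eqP] := ltngtP (m (var_idx i j)) (m' (var_idx i j)).
- have lt' : (m (var_idx j i) < m' (var_idx j i))%N by lia.
  have [m1 [Pm1 eqd1 lt_d]] := P_step K ij lt lt'.
  rewrite -['X_[m]](subrK 'X_[m1]) -addrA; apply: ideal_genD.
    by apply: IHd; rewrite ?eqd1 // off_distC (leq_trans lt_d) // off_distC.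
  by rewrite -opprB -mulN1r; apply: ideal_genM.
- have lt' : (m' (var_idx j i) < m (var_idx j i))%N by lia.
  have [m1 [Pm1 eqd1 lt_d]] := P_step K ij lt lt'.
  rewrite -['X_[m]](subrK 'X_[m1]) -addrA; apply: ideal_genD => //.
  by apply: IHd; rewrite ?eqd1 // (leq_trans lt_d).
by rewrite (negPf ne).
Qed.

(** The generators lie in the kernel by [square_deg], and the kernel is spanned by
    binomials, which lie in P_G by [P_kernel]. *)
Lemma P_ideal_toric (K : fieldType) (p : {mpoly K[N]}) :
  P_ideal K G p <-> toric_map (incidence (prism G) ev) p = 0.
Proof.
split.
  apply: (ideal_gen_min (J := fun p => toric_map _ p = 0))
    => [|q r Jq Jr|a q Jq|_ [i [j [lt_ij ij ->]]]].
  - by rewrite /toric_map mmap0.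
  - by rewrite /toric_map mmapD -!/(toric_map _ _) Jq Jr addr0.
  - by rewrite /toric_map (mmap_is_multiplicative _ _).1 -!/(toric_map _ _) Jq mulr0.
  have ji : adj G j i by rewrite adj_sym.
  rewrite !x_var_idx ?eqxx ?ij ?ji ?orbT // -!mpolyXD.
  by apply: toric_binomial; rewrite square_deg.
apply: (toric_binomials_span (J := P_ideal K G)).
- exact: ideal_gen0.
- exact: ideal_genD.
- exact: ideal_genM.
- exact: P_kernel.
Qed.

Lemma cycle_binomialE (K : fieldType) c : is_cycle (prism G) c ->
  exists b, cycle_binomial K G c
    = 'X_[cycle_mon ev prism_color c b] - 'X_[cycle_mon ev prism_color c (~~ b)].
Proof.
move=> cyc; have [gt2 /andP[cyc_c uniq_c]] := cyc.
have [u0 _] := cycle_nonempty cyc.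
exists (prism_color (nth u0 c 0)); rewrite /cycle_binomial.
set es := map _ _.
have es_nth (k : nat) : (k < size c)%N ->
    es`_k = 'X_(ev (nth u0 c k) (nth u0 (rot 1 c) k)).
  move=> lt_k; rewrite (nth_map (u0, u0)) ?size_zip ?size_rot ?minnn //.
  rewrite nth_zip ?size_rot //= edge_var_ev // -next_nth_rot //.
  exact: (next_cycle cyc_c (mem_nth _ lt_k)).
have half (e : bool) : \prod_(j < (size c)./2) es`_(j.*2 + e)
    = 'X_[cycle_mon ev prism_color c (prism_color (nth u0 c 0) (+) e)].
  rewrite (@cycle_mon_half _ (prism G) _ ev _ prism_color_adj _ cyc) -mprodXE.
  apply: eq_bigr => j _.
  apply: es_nth; have := @cycle_even _ (prism G) _ prism_color_adj _ cyc.
  by case: e; have := ltn_ord j; lia.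
have := half false; have := half true; rewrite addbF addbT => <- <-.
by congr (_ - _); apply: eq_bigr => j _; rewrite ?addn1 ?addn0.
Qed.

End Prism.

Theorem theorem3p16 (K : fieldType) (n : nat) (G : simple_graph 'I_n)
    (treeG : is_tree G) (f : {mpoly K[#|var G|]}) :
  up_to_sign (universal_groebner (P_ideal K G)) f <->
  up_to_sign (even_cycle_binomial K G) f.
Proof.
case: treeG => _ _ acyclic.
rewrite (@bipartite_universal_groebner _ (prism G) _ (@prism_ev n G) _
  (@prism_ev_sym n G) (@prism_ev_inj n G) (@prism_ev_surj n G)
  (prism_color_adj acyclic) K _ f (P_ideal_toric acyclic (K := K))).
(* Starting the cycle at a vertex of the other colour changes the sign of its
   binomial. *)
pose mon := cycle_mon (@prism_ev n G) (prism_color G).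
have sign c : is_cycle (prism G) c -> let g := 'X_[mon c true] - 'X_[mon c false] in
    g = cycle_binomial K G c \/ - g = cycle_binomial K G c.
  move=> /(cycle_binomialE acyclic K)[[] ->] /=; first by left.
  by right; rewrite opprB.
have even c : is_cycle (prism G) c -> is_even_cycle (prism G) c.
  by move=> cyc; split=> //; apply: (@cycle_even _ (prism G) _ (prism_color_adj acyclic) _ cyc).
split=> -[] [c [cyc def_f]].
- rewrite def_f; case: (sign c cyc) => eq_g; [left|right];
    by exists c; split; [apply: even | rewrite eq_g].
- rewrite -[f]opprK def_f; case: (sign c cyc) => eq_g; [right|left];
    by exists c; split; [apply: even | rewrite ?opprK eq_g].
- case: cyc => cyc _; rewrite def_f; case: (sign c cyc) => <-; [left|right];
    by exists c; rewrite ?opprK.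
- case: cyc => cyc _; rewrite -[f]opprK def_f.
  case: (sign c cyc) => <-; [right|left]; by exists c; rewrite ?opprK.
Qed.
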